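(* Let $n\geq 5$ be an integer and let $\lambda>1$ be an integer with $(n-2)/3\leq\lambda\leq n-2$ such that $n-\lambda$ is even. There exists an indecomposable $1$-factorization of $\lambda K_{2n}$ which is not simple.
   Context: The complete multigraph $\lambda K_{2n}$ has $2n$ vertices, and each pair of distinct vertices is joined by exactly $\lambda$ edges. A $1$-factor of $\lambda K_{2n}$ is a spanning subgraph consisting of $n$ pairwise independent edges (a perfect matching); two $1$-factors are regarded as equal if they consist of the same unordered pairs of vertices. A $1$-factorization of $\lambda K_{2n}$ is a partition of the edge-(multi)set of $\lambda K_{2n}$ into $1$-factors, i.e. a multiset of $1$-factors such that every pair of distinct vertices is covered exactly $\lambda$ times, counting multiplicities. A $1$-factorization is simple if no $1$-factor is repeated in it. It is decomposable if it is the (multiset) union of a $1$-factorization of $\lambda_0K_{2n}$ and a $1$-factorization of $(\lambda-\lambda_0)K_{2n}$ for some integer $\lambda_0$ with $1\le\lambda_0<\lambda$; otherwise it is indecomposable. *)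

(* Defs.v *)
From mathcomp Require Import all_boot finmap multiset.

Set Implicit Arguments.
Unset Strict Implicit.
Unset Printing Implicit Defensive.

Local Open Scope mset_scope.
Local Open Scope nat_scope.

(* A graph on the 2n vertices 'I_(2 * n) is given by its set of edges, an edge
   being a 2-element set of vertices. *)
Definition one_factor (n : nat) (F : {set {set 'I_(2 * n)}}) : bool :=
  [&& [forall e in F, #|e| == 2], #|F| == n & trivIset F].

(* M F is the multiplicity of F in the multiset M; the sum runs over all edge
   sets F, those outside M contributing 0. *)
Definition one_factorization (n lambda : nat)
    (M : {mset {set {set 'I_(2 * n)}}}) : Prop :=
  (forall F, F \in M -> one_factor F) /\
  (forall x y : 'I_(2 * n), x != y ->
     \sum_(F : {set {set 'I_(2 * n)}} | [set x; y] \in F) M F = lambda).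

Definition simple_factorization (n : nat)
    (M : {mset {set {set 'I_(2 * n)}}}) : Prop :=
  forall F, M F <= 1.

(* `+` adds multiplicities. *)
Definition decomposable (n lambda : nat)
    (M : {mset {set {set 'I_(2 * n)}}}) : Prop :=
  exists lambda0 : nat, 1 <= lambda0 < lambda /\
    exists M1 M2 : {mset {set {set 'I_(2 * n)}}},
      [/\ one_factorization lambda0 M1,
          one_factorization (lambda - lambda0) M2 &
          M = M1 `+` M2].

(* Main.v *)
Require Import Defs.
From mathcomp Require Import all_boot finmap multiset.
From mathcomp Require Import all_fingroup all_algebra.
From mathcomp Require Import ring zify.

Set Implicit Arguments.
Unset Strict Implicit.
Unset Printing Implicit Defensive.

Import GRing.Theory.

Local Open Scope mset_scope.
Local Open Scope nat_scope.

(** Let [R] be the ring of integers modulo [n], and split the [2n] vertices into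
two copies [u_i], [v_i] of [R]. An involution [p] of [R] and a shift [r] give a
1-factor: the pairs [{i, p i}] are copied on the [u]-side and, translated by
[r], on the [v]-side, and a fixed point [i] of [p] gives the spoke
[u_i v_(i+r)] ([shifted_double]).

Reflections [i |-> s - i] cover every pair of [R] once, as [s] runs over [R],
and fix every point exactly once (a point [i] is fixed for [s = 2i]). So with
multiplicity [lambda - 1] and shift [1] they cover each pair inside a side
[lambda - 1] times, and one extra copy of the all-spokes factor of shift [1]
completes the spokes of shift [1]. The remaining cover of the pairs inside a
side is made by the reflections again, with shift [0], but after [lambda - 1]
chords [{k - 1, k + 1}], [k] in [J], have been taken out of them; each of these
chords becomes the only pair of a 1-factor of its own. Every point is then
fixed [lambda] times in the shift [0] part. All other shifts are served by
[lambda] copies of their all-spokes factor, which makes the 1-factorization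
not simple.

Why it is indecomposable. Suppose that a part covers every edge [lambda0]
times, and contains [z], either 0 or 1, times the single all-spokes factor of
shift [1]. The spoke [u_i v_(i+1)] forces the number of copies of the
reflection [s = 2i] of shift [1] to be [lambda0 - z]. The pairs on the [u]-side
whose sum is [2i] are covered by these copies and by exactly one factor of
shift [0], so that each factor of shift [0] containing such a pair occurs [z]
times. Now every chord [{k - 1, k + 1}] has the sum [2k]; and a trimmed
reflection with a fixed point has an [s] of the form [2k], and it still contains
a pair ([trimmed_even_edge]). So all factors that contain a spoke of shift [0]
occur [z] times. The [lambda] factors through the spoke
[u_0 v_0] give [lambda0 = z * lambda]: the part is empty or everything
([double_indecomposable]).

The multiset is handled through a family of labelled involutions of the vertex
set with multiplicities ([factorization_of_pairings]). *)

(** * One-factors as fixed-point-free involutions *)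

Definition pairing (T : finType) (t : T -> T) : {set {set T}} :=
  [set [set x; t x] | x : T].

Lemma mem_pairing (T : finType) (t : T -> T) (x y : T) :
  involutive t -> x != y -> ([set x; y] \in pairing t) = (t x == y).
Proof.
move=> tK neq_xy; apply/imsetP/eqP => [[z _ Exy] | <-]; last by exists x.
have /set2P[Ex|Ex] : x \in [set z; t z] by rewrite -Exy set21.
  have /set2P[Ey|->] : y \in [set z; t z] by rewrite -Exy set22.
    by rewrite Ex Ey eqxx in neq_xy.
  by rewrite Ex.
have /set2P[->|Ey] : y \in [set z; t z] by rewrite -Exy set22.
  by rewrite Ex tK.
by rewrite Ex Ey eqxx in neq_xy.
Qed.

Lemma pairing_one_factor (n : nat) (t : 'I_(2 * n) -> 'I_(2 * n)) :
  involutive t -> (forall x, t x != x) -> one_factor (pairing t).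
Proof.
move=> tK t_free.
have card2 e : e \in pairing t -> #|e| = 2.
  by case/imsetP=> x _ ->; rewrite cards2 eq_sym t_free.
have sameP x y : y \in [set x; t x] -> [set y; t y] = [set x; t x].
  by rewrite !inE => /orP[]/eqP-> //; rewrite tK setUC.
have tiP : trivIset (pairing t).
  apply/trivIsetP=> _ _ /imsetP[x _ ->] /imsetP[y _ ->] neq.
  apply/pred0P=> z; apply/negP=> /andP[zx zy].
  by case/eqP: neq; rewrite -(sameP _ _ zx) -(sameP _ _ zy).
have cover_all : cover (pairing t) = [set: 'I_(2 * n)].
  apply/setP=> x; rewrite in_setT; apply/bigcupP.
  by exists [set x; t x]; rewrite ?set21 //; apply/imsetP; exists x.
apply/and3P; split=> //; first by apply/forall_inP=> e /card2->.
have : partition (pairing t) [set: 'I_(2 * n)].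
  apply/and3P; split=> //; first by rewrite cover_all.
  by apply/negP=> /card2; rewrite cards0.
move/(card_uniform_partition card2); rewrite cardsT card_ord.
by move=> E; rewrite -(eqn_pmul2l (isT : 0 < 2)) mulnC -E.
Qed.

(** * Multisets of one-factors as weights on labels *)

Lemma weights_below (I : finType) (P : pred I) (m : I -> nat) (k : nat) :
  k <= \sum_(a | P a) m a ->
  exists f : {ffun I -> nat},
    (forall a, f a <= m a) /\ \sum_(a | P a) f a = k.
Proof.
elim: k => [|k IHk] lek.
  by exists [ffun=> 0]; split=> [a|]; rewrite ?big1 // => *; rewrite ffunE.
have [f [lefm Ef]] := IHk (ltnW lek).
have [a Pa lta] : exists2 a, P a & f a < m a.
  apply/exists_inP; apply: contraLR lek.
  rewrite negb_exists_in => /forall_inP H.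
  by rewrite -leqNgt -Ef leq_sum // => a /H; rewrite -leqNgt.
exists [ffun b => f b + (b == a)]; split=> [b|].
  by rewrite ffunE; case: eqP => [->|_]; rewrite ?addn1 ?addn0.
under eq_bigr do rewrite ffunE.
rewrite big_split /= Ef (bigD1 a) //= eqxx.
by rewrite big1 ?addn1 // => b /andP[_ /negPf->].
Qed.

(** Two labels may carry the same object; a multiset [g] contained in the
weighted image of [F] still lifts to weights on the labels, by distributing
each [g x] over the fibre of [x]. So sub-multisets can be studied label by
label, even where labels share a 1-factor. *)
Lemma sub_multiset_weights (I K : finType) (F : I -> K) (m : I -> nat)
    (g : K -> nat) :
  (forall x, g x <= \sum_(a | F a == x) m a) ->
  exists f : I -> nat, (forall a, f a <= m a) /\
    forall Q : pred K, \sum_(x | Q x) g x = \sum_(a | Q (F a)) f a.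
Proof.
move=> leg.
have /fin_all_exists [f Hf] x := weights_below (leg x).
exists (fun a => f (F a) a); split=> [a|Q]; first by case: (Hf (F a)).
rewrite (partition_big F Q) //=; apply: eq_bigr => x Qx.
rewrite -(proj2 (Hf x)); apply: eq_big => [a|a /eqP->] //.
by case: eqP => [->|_]; rewrite ?Qx ?andbF.
Qed.

(** Reduction of the problem to weights on a labelled family [t] of
fixed-point-free involutions of any set [V] of [2n] vertices. Indecomposability
becomes the statement that weights [f] below [m] that cover all pairs equally
often do so [0] or [lambda] times. *)
Lemma factorization_of_pairings (n lambda : nat) (I V : finType)
    (t : I -> V -> V) (m : I -> nat) :
  #|V| = 2 * n ->
  (forall a, involutive (t a)) -> (forall a x, t a x != x) ->
  (forall x y, x != y -> \sum_(a | t a x == y) m a = lambda) ->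
  (forall (f : I -> nat) (l0 : nat), (forall a, f a <= m a) ->
     (forall x y, x != y -> \sum_(a | t a x == y) f a = l0) ->
     l0 = 0 \/ l0 = lambda) ->
  (exists a, 1 < m a) ->
  exists M : {mset {set {set 'I_(2 * n)}}},
    [/\ one_factorization lambda M,
        ~ decomposable lambda M &
        ~ simple_factorization M].
Proof.
move=> cardV tK t_free t_cover t_indec [a0 ma0].
pose h (x : 'I_(2 * n)) : V := enum_val (cast_ord (esym cardV) x).
pose h' (v : V) : 'I_(2 * n) := cast_ord cardV (enum_rank v).
have hK : cancel h h' by move=> x; rewrite /h /h' enum_valK cast_ordKV.
have h'K : cancel h' h by move=> v; rewrite /h /h' cast_ordK enum_rankK.
pose F a := pairing (fun x => h' (t a (h x))).
have FK a : involutive (fun x => h' (t a (h x))) by move=> x; rewrite h'K tK hK.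
have memF a x y : x != y -> ([set x; y] \in F a) = (t a (h x) == h y).
  by move=> neq; rewrite mem_pairing // (can2_eq h'K hK).
have F1 a : one_factor (F a).
  by apply: pairing_one_factor => // x; rewrite (can2_eq h'K hK) t_free.
pose M : {mset {set {set 'I_(2 * n)}}} :=
  seq_mset (flatten [seq nseq (m a) (F a) | a <- enum I]).
have ME G : M G = \sum_(a | F a == G) m a.
  rewrite mset_seqE count_flatten -map_comp sumn_map big_enum /=.
  rewrite [RHS]big_mkcond.
  by apply: eq_bigr => a _; rewrite /= count_nseq /=; case: eqP; rewrite ?mul1n.
exists M; split.
- split=> [G | x y neq_xy].
    rewrite in_mset ME lt0n sum_nat_eq0 negb_forall_in.
    by case/exists_inP=> a /eqP <-.
  under eq_bigr do rewrite ME.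
  rewrite (eq_bigr
    (fun G => \sum_(a | ([set x; y] \in F a) && (F a == G)) m a)).
    rewrite -(partition_big F (fun G => [set x; y] \in G)) //.
    rewrite -(t_cover (h x) (h y)) ?(can_eq hK) //.
    by apply: eq_bigl => a; rewrite memF.
  move=> G xyG; apply: eq_bigl => a.
  by case: eqP => [->|_]; rewrite ?xyG ?andbF.
- case=> l0 [/andP[l0_gt0 l0_lt] [M1 [M2 [[_ M1_cover] _ EM]]]].
  have le_M1 G : M1 G <= \sum_(a | F a == G) m a.
    by rewrite -ME EM msetE2 leq_addr.
  have [f [le_fm Ef]] := sub_multiset_weights le_M1.
  have := t_indec f l0 le_fm.
  case=> [u v neq_uv | El0 | El0]; last 2 first.
  + by rewrite El0 in l0_gt0.
  + by rewrite El0 ltnn in l0_lt.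
  have neq : h' u != h' v by rewrite (can_eq h'K).
  rewrite -(M1_cover _ _ neq) (Ef (fun G => [set h' u; h' v] \in G)).
  by apply: eq_bigl => a; rewrite memF // !h'K.
- move/(_ (F a0)); apply/negP; rewrite -ltnNge ME (bigD1 a0) //=.
  exact: leq_trans (leq_addr _ _).
Qed.

(** * The one-factor of an involution and a shift *)

Definition shifted_double (R : zmodType) (p : R -> R) (r : R) (x : R + R) :
    R + R :=
  (match x with
   | inl i => if p i == i then inr (i + r) else inl (p i)
   | inr i => if p (i - r) == i - r then inl (i - r) else inr (p (i - r) + r)
   end)%R.

Lemma shifted_doubleK (R : zmodType) (p : R -> R) (r : R) :
  involutive p -> involutive (shifted_double p r).
Proof.
move=> pK [] i /=.
  case: (eqVneq (p i) i) => [Ei | ne] /=; first by rewrite addrK Ei eqxx.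
  by rewrite pK eq_sym (negPf ne).
case: (eqVneq (p (i - r)%R) (i - r)%R) => [Ei | ne] /=.
  by rewrite Ei eqxx subrK.
by rewrite addrK pK eq_sym (negPf ne) subrK.
Qed.

Lemma shifted_double_free (R : zmodType) (p : R -> R) (r : R) (x : R + R) :
  shifted_double p r x != x.
Proof.
case: x => i /=.
  by case: (eqVneq (p i) i).
case: (eqVneq (p _) (i - r)%R) => //= ne; apply: contra ne => /eqP[Ei].
by rewrite -[in X in _ == X]Ei addrK.
Qed.

Lemma shifted_double_ll (R : zmodType) (p : R -> R) (r i j : R) :
  i != j -> (shifted_double p r (inl i) == inl j) = (p i == j).
Proof.
by move=> neq /=; case: (eqVneq (p i) i) => // ->; rewrite (negPf neq).
Qed.

Lemma shifted_double_lr (R : zmodType) (p : R -> R) (r i j : R) :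
  (shifted_double p r (inl i) == inr j) = (r == j - i)%R && (p i == i).
Proof.
rewrite /=; case: (eqVneq (p i) i); rewrite ?andbF ?andbT //= => _.
by rewrite [RHS]eq_sym subr_eq addrC eq_sym.
Qed.

Lemma shifted_double_rr (R : zmodType) (p : R -> R) (r i j : R) :
  i != j -> (shifted_double p r (inr i) == inr j) = (p (i - r) == j - r)%R.
Proof.
move=> neq /=; case: (eqVneq (p _) (i - r)%R) => [->|_].
  by rewrite (inj_eq (addIr _)) (negPf neq).
by rewrite [RHS]eq_sym subr_eq eq_sym.
Qed.

(** * The labelled family of one-factors *)

Definition removed (R : finComNzRingType) (J : {set R}) (i j : R) : bool :=
  [exists k in J, tperm (k - 1) (k + 1) i == j]%R.

Lemma removedC (R : finComNzRingType) (J : {set R}) (i j : R) :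
  removed J i j = removed J j i.
Proof.
apply: eq_existsb => k; congr (_ && _).
by rewrite (can2_eq (tpermK _ _) (tpermK _ _)) eq_sym.
Qed.

Lemma chord_midpoint (R : finComNzRingType) (i j k : R) :
  i != j -> tperm (k - 1)%R (k + 1)%R i == j -> (i + j = k + k)%R.
Proof.
move=> neq /eqP; case: tpermP => [-> <-|-> <-|_ _ E].
- by ring.
- by ring.
- by rewrite E eqxx in neq.
Qed.

(** The chords are distinct: [{k - 1, k + 1} = {l - 1, l + 1}] with the ends
crossed would give [4 = 0]. *)
Lemma chord_inj (R : finComNzRingType) (i j k l : R) :
  (4 != 0 :> R)%R -> i != j -> tperm (k - 1)%R (k + 1)%R i == j ->
  tperm (l - 1)%R (l + 1)%R i == j -> k = l.
Proof.
move=> four neq /eqP Ek /eqP El.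
have crossed (m m' : R) : (m - 1 = m' + 1)%R -> (m + 1 = m' - 1)%R -> False.
  move=> E1 E2; case/eqP: four.
  have -> : (4 = (m + 1) - (m' - 1) - ((m - 1) - (m' + 1)) :> R)%R by ring.
  by rewrite E1 E2 !subrr.
move: Ek El; case: tpermP => [Ei Ej|Ei Ej|_ _ E]; last by rewrite E eqxx in neq.
  case: tpermP => [Ei' _|Ei' Ej'|_ _ E]; last by rewrite E eqxx in neq.
    by apply: (addIr (-1)%R); rewrite -Ei.
  by case: (crossed k l); rewrite ?Ej -?Ei.
case: tpermP => [Ei' Ej'|Ei' _|_ _ E]; last by rewrite E eqxx in neq.
  by case: (crossed l k); rewrite ?Ej' -?Ei'.
by apply: (addIr 1%R); rewrite -Ei.
Qed.

(** A sum of four copies of the ring, so that sums over labels split by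
[big_sumType]. The constructors are named as follows: [trimmed s] is the
reflection [s - i] without the removed chords, [chord k] the single pair
[{k - 1, k + 1}], [full s] the whole reflection, and [spokes r] the factor
without pairs inside a side. *)
Definition label (R : finComNzRingType) : finType := ((R + R) + (R + R))%type.
Notation trimmed s := (inl (inl s)).
Notation chord k := (inl (inr k)).
Notation full s := (inr (inl s)).
Notation spokes r := (inr (inr r)).

Definition partner (R : finComNzRingType) (J : {set R}) (a : label R) :
    R -> R :=
  match a with
  | trimmed s => fun i => if removed J i (s - i)%R then i else (s - i)%R
  | chord k => tperm (k - 1)%R (k + 1)%R
  | full s => fun i => (s - i)%R
  | spokes _ => id
  end.

Definition shift (R : finComNzRingType) (a : label R) : R :=
  match a with inl _ => 0 | full _ => 1 | spokes r => r end%R.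

(** The factor [spokes r] supplies the spokes of shift [r] that the other labels
leave uncovered: none for [r = 0], one copy for [r = 1]. *)
Definition multiplicity (R : finComNzRingType) (J : {set R}) (lambda : nat)
    (a : label R) : nat :=
  match a with
  | trimmed _ => 1
  | chord k => k \in J
  | full _ => lambda.-1
  | spokes r => if r == 0%R then 0 else if r == 1%R then 1 else lambda
  end.

Lemma partnerK (R : finComNzRingType) (J : {set R}) (a : label R) :
  involutive (partner J a).
Proof.
case: a => [[s|k]|[s|r]] i //=; last 2 first.
- exact: tpermK.
- exact: subKr.
by case E: (removed J i (s - i)%R); rewrite ?E // subKr removedC E.
Qed.

(** * Covering numbers *)

Lemma sum_label (R : finComNzRingType) (P : pred (label R))
    (f : label R -> nat) :
  \sum_(a | P a) f a =
  (\sum_(s | P (trimmed s)) f (trimmed s) +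
   \sum_(k | P (chord k)) f (chord k)) +
  (\sum_(s | P (full s)) f (full s) + \sum_(r | P (spokes r)) f (spokes r)).
Proof. by rewrite big_sumType /= !big_sumType. Qed.

Lemma sum_reflection (R : finComNzRingType) (g : R -> nat) (i j : R) :
  \sum_(s | (s - i == j)%R) g s = g (i + j)%R.
Proof.
by rewrite (big_pred1 (i + j)%R) // => s; rewrite subr_eq addrC.
Qed.

Lemma sum_fibres (I K : finType) (p : I -> K) (f : I -> nat) :
  \sum_j \sum_(a | p a == j) f a = \sum_a f a.
Proof. by rewrite [RHS](partition_big p predT). Qed.

Lemma sum_trimmed (R : finComNzRingType) (J : {set R}) (g : R -> nat)
    (i j : R) :
  i != j ->
  \sum_(s | partner J (trimmed s) i == j) g s =
  if removed J i j then 0 else g (i + j)%R.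
Proof.
move=> neq; rewrite -(sum_reflection g i j) /=.
case: ifP => rem_ij.
  rewrite big1 // => s; case: ifP => [_ /eqP E|nrem /eqP E].
    by rewrite E eqxx in neq.
  by rewrite E rem_ij in nrem.
apply: eq_bigl => s; case: ifP => // rem_s; rewrite (negPf neq).
by apply/esym/eqP=> E; rewrite E rem_ij in rem_s.
Qed.

Lemma sum_chord (R : finComNzRingType) (J : {set R}) (g : R -> nat) (i j : R) :
  (4 != 0 :> R)%R -> i != j ->
  forall k, tperm (k - 1)%R (k + 1)%R i == j ->
  \sum_(l | partner J (chord l) i == j) g l = g k.
Proof.
move=> four neq k Ek; rewrite (bigD1 k) //= big1 ?addn0 // => l /andP[El].
by rewrite (chord_inj four neq El Ek) eqxx.
Qed.

Lemma sum_chord0 (R : finComNzRingType) (J : {set R}) (g : R -> nat) (i j : R) :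
  (forall k, g k <= (k \in J)) -> ~~ removed J i j ->
  \sum_(l | partner J (chord l) i == j) g l = 0.
Proof.
move=> le_g nrem; rewrite big1 // => l El; apply/eqP.
rewrite -leqn0 (leq_trans (le_g l)) // leqn0 eqb0; apply: contra nrem => lJ.
by apply/exists_inP; exists l.
Qed.

Lemma cover_unshifted (R : finComNzRingType) (J : {set R}) (i j : R) :
  (4 != 0 :> R)%R -> i != j ->
  \sum_(s | partner J (trimmed s) i == j) 1 +
  \sum_(k | partner J (chord k) i == j) (k \in J) = 1.
Proof.
move=> four neq; rewrite (sum_trimmed _ (fun=> 1)) //.
case: ifP => [rem|/negbT nrem].
  have /exists_inP[k kJ Ek] := rem.
  by rewrite (sum_chord J (fun k => k \in J : nat) four neq Ek) kJ.
by rewrite (sum_chord0 (J := J) (g := fun k => k \in J : nat)).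
Qed.

(** Double counting: at a given [i], the labels of shift [0] have total
multiplicity [#|R| + #|J|], and each of the [#|R| - 1] other points takes one
of them as a partner of [i] by [cover_unshifted]. *)
Lemma fixed_unshifted (R : finComNzRingType) (J : {set R}) (i : R) :
  (4 != 0 :> R)%R ->
  \sum_(s | partner J (trimmed s) i == i) 1 +
  \sum_(k | partner J (chord k) i == i) (k \in J) = #|J|.+1.
Proof.
move=> four.
pose w j := \sum_(s | partner J (trimmed s) i == j) 1 +
  \sum_(k | partner J (chord k) i == j) (k \in J).
have : \sum_j w j = #|R| + #|J|.
  rewrite big_split !sum_fibres sum1_card; congr (_ + _).
  by rewrite -sum1_card [RHS]big_mkcond; apply: eq_bigr => k _; case: (k \in J).
rewrite -/(w i) (bigD1 i) //= (eq_bigr (fun=> 1)) => [|j ne]; last first.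
  by apply: cover_unshifted; rewrite // eq_sym.
rewrite sum1_card cardC1.
have Rgt0 : 0 < #|R| by apply/card_gt0P; exists i.
by rewrite -{2}(prednK Rgt0) addSn -addnS addnC => /addnI.
Qed.

Lemma double_cover_spoke (R : finComNzRingType) (J : {set R}) (lambda : nat)
    (i j : R) :
  (4 != 0 :> R)%R -> 0 < lambda -> #|J| = lambda.-1 ->
  \sum_(a | shifted_double (partner J a) (shift a) (inl i) == inr j)
     multiplicity J lambda a = lambda.
Proof.
move=> four lambda_gt0 cardJ.
under eq_bigl do rewrite shifted_double_lr.
rewrite sum_label /=; move: (j - i)%R => r.
have -> : \sum_(t | (t == r) && (i == i))
      (if t == 0 then 0 else if t == 1 then 1 else lambda)%R =
    (if r == 0 then 0 else if r == 1 then 1 else lambda)%R.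
  by apply: big_pred1 => t; rewrite eqxx andbT.
case: (eqVneq r 0%R) => [->|r0].
  rewrite (fixed_unshifted J i) // cardJ prednK // big_pred0 ?addn0 // => s.
  by rewrite oner_eq0.
rewrite /= !big_pred0_eq add0n.
case: (eqVneq r 1%R) => [_|_].
  by rewrite sum_reflection addn1 prednK.
by rewrite !big_pred0_eq.
Qed.

Lemma double_cover (R : finComNzRingType) (J : {set R}) (lambda : nat)
    (x y : R + R) :
  (4 != 0 :> R)%R -> 0 < lambda -> #|J| = lambda.-1 -> x != y ->
  \sum_(a | shifted_double (partner J a) (shift a) x == y)
     multiplicity J lambda a = lambda.
Proof.
move=> four lambda_gt0 cardJ; case: x y => i [] j.
- rewrite (inj_eq inl_inj) => neq.
  under eq_bigl do rewrite shifted_double_ll //.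
  rewrite sum_label cover_unshifted // sum_reflection big_pred0 => [|r] /=.
    by rewrite addn0 add1n prednK.
  exact: negbTE.
- by move=> _; apply: double_cover_spoke.
- move=> _; rewrite -[RHS](double_cover_spoke (J := J) j i) //.
  apply: eq_bigl => a.
  have dK := shifted_doubleK (shift a) (@partnerK _ J a).
  by rewrite (can2_eq dK dK) eq_sym.
- rewrite (inj_eq inr_inj) => neq.
  under eq_bigl do rewrite shifted_double_rr //.
  rewrite sum_label /= !subr0 (cover_unshifted J four neq) sum_reflection.
  rewrite big_pred0 => [|r] /=.
    by rewrite addn0 add1n prednK.
  by rewrite (inj_eq (addIr _)) (negPf neq).
Qed.

(** * Indecomposability *)

(** A trimmed reflection of even index [2k] keeps an edge: [{k - 1, k + 1}] if
[k] is not in [J], and [{k - 2, k + 2}] otherwise. The latter can be a chord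
[{l - 1, l + 1}] only if [l = k - 3] and [6 = 0], which is what the condition
on [J] excludes. *)
Lemma trimmed_even_edge (R : finComNzRingType) (J : {set R}) (k : R) :
  (4 != 0 :> R)%R -> (forall l, l \in J -> 6 = 0 :> R -> l + 3 \notin J)%R ->
  exists i j, [/\ i != j, ~~ removed J i j & i + j = k + k]%R.
Proof.
move=> four Jsep.
have two : (2 != 0 :> R)%R.
  by apply: contraNneq four => E; rewrite (natrM R 2 2 : 4 = _)%R E mul0r.
have [kJ | kNJ] := boolP (k \in J).
  exists (k - 2)%R, (k + 2)%R; split; last by ring.
    rewrite -subr_eq0; have -> : (k - 2 - (k + 2) = - 4 :> R)%R by ring.
    by rewrite oppr_eq0.
  apply/exists_inP=> -[l lJ /eqP]; case: tpermP => [E1 E2|E1 E2|_ _ E].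
  - have El : (l = k - 1)%R by rewrite -[l](subrK 1%R) -E1; ring.
    have E : (2 = k + 2 - k :> R)%R by ring.
    by case/eqP: two; rewrite E -E2 El; ring.
  - have El : (l = k - 3)%R by rewrite -[l](addrK 1%R) -E1; ring.
    have E6 : (6 = 0 :> R)%R.
      have -> : (6 = k + 2 - (k - 3 - 1) :> R)%R by ring.
      by rewrite -El E2 subrr.
    by have := Jsep _ lJ E6; rewrite El subrK kJ.
  - case/eqP: four; have -> : (4 = k + 2 - (k - 2) :> R)%R by ring.
    by rewrite E subrr.
have neq : (k - 1 != k + 1 :> R)%R.
  rewrite -subr_eq0; have -> : (k - 1 - (k + 1) = - 2 :> R)%R by ring.
  by rewrite oppr_eq0.
exists (k - 1)%R, (k + 1)%R; split=> //; last by ring.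
apply/exists_inP=> -[l lJ El]; case/negP: kNJ.
suff -> : k = l by [].
by apply: (chord_inj four neq _ El); rewrite tpermL.
Qed.

Lemma double_indecomposable (R : finComNzRingType) (J : {set R}) (lambda : nat)
    (f : label R -> nat) (lambda0 : nat) :
  (4 != 0 :> R)%R -> 0 < lambda -> #|J| = lambda.-1 ->
  (forall k, k \in J -> 6 = 0 :> R -> k + 3 \notin J)%R ->
  (forall a, f a <= multiplicity J lambda a) ->
  (forall x y, x != y ->
     \sum_(a | shifted_double (partner J a) (shift a) x == y) f a = lambda0) ->
  lambda0 = 0 \/ lambda0 = lambda.
Proof.
move=> four lambda_gt0 cardJ Jsep le_fm cover_f.
pose z := f (spokes 1%R).
have le_fJ k : f (chord k) <= (k \in J) by exact: (le_fm (chord k)).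
have spoke1 i : f (full (i + i)%R) + z = lambda0.
  rewrite -(cover_f (inl i) (inr (i + 1)%R)) //.
  under eq_bigl do rewrite shifted_double_lr addrC addKr.
  rewrite sum_label /= ![\sum_(_ | (0 == 1)%R && _) _]big_pred0; last first.
  - by move=> s; rewrite eq_sym oner_eq0.
  - by move=> s; rewrite eq_sym oner_eq0.
  rewrite eqxx sum_reflection (big_pred1 1%R) // => r.
  by rewrite eqxx andbT.
have side_edge i j : i != j ->
    \sum_(s | partner J (trimmed s) i == j) f (trimmed s) +
    \sum_(k | partner J (chord k) i == j) f (chord k) +
    f (full (i + j)%R) = lambda0.
  move=> neq; have /cover_f : inl i != inl j :> R + R by [].
  under eq_bigl do rewrite shifted_double_ll //.
  by rewrite sum_label /= sum_reflection (negPf neq) big_pred0_eq addn0.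
have trimmed_z k : f (trimmed (k + k)%R) = z.
  have [i [j [neq nrem Ek]]] := trimmed_even_edge k four Jsep.
  have := side_edge i j neq; rewrite sum_trimmed // (negPf nrem).
  rewrite (sum_chord0 (g := fun k => f (chord k))) // Ek addn0.
  by rewrite -(spoke1 k) addnC => /addnI.
have chord_z k : k \in J -> f (chord k) = z.
  move=> kJ.
  have neq : (k - 1 != k + 1 :> R)%R.
    apply: contraNneq four => E.
    have -> : (4 = 2 * ((k + 1) - (k - 1)) :> R)%R by ring.
    by rewrite E subrr mulr0.
  have Ek : (tperm (k - 1) (k + 1) (k - 1) == k + 1)%R by rewrite tpermL.
  have := side_edge _ _ neq; rewrite sum_trimmed //.
  have -> : removed J (k - 1)%R (k + 1)%R by apply/exists_inP; exists k.
  rewrite (sum_chord J (fun k => f (chord k)) four neq Ek) add0n.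
  have -> : (k - 1 + (k + 1) = k + k)%R by ring.
  by rewrite -(spoke1 k) addnC => /addnI.
(* The spoke u_0 v_0, compared term by term with the count of all labels of
   shift 0 that fix the point 0. *)
have lambda0E : lambda0 = z * lambda.
  rewrite -(cover_f (inl 0%R) (inr 0%R)) //.
  under eq_bigl do rewrite shifted_double_lr subrr.
  rewrite sum_label -[in RHS](prednK lambda_gt0) -cardJ.
  rewrite -(fixed_unshifted J 0%R four) -[RHS]addn0; congr (_ + _); last first.
    apply/eqP; rewrite addn_eq0 !sum_nat_eq0 /=.
    apply/andP; split; apply/forall_inP=> s; first by rewrite oner_eq0.
    by case/andP=> /eqP-> _; have := le_fm (spokes 0%R); rewrite /= eqxx leqn0.
  rewrite mulnDr !big_distrr /=; congr (_ + _).
    apply: eq_big => [s|s /andP[_ /eqP]]; first by rewrite eqxx.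
    rewrite muln1; case: ifP => [/exists_inP[k kJ Ek] _|_]; last first.
      by rewrite subr0 => ->; rewrite -[0%R]addr0 trimmed_z.
    have [->|s0] := eqVneq s 0%R; first by rewrite -[0%R]addr0 trimmed_z.
    have neq : 0%R != (s - 0)%R :> R by rewrite subr0 eq_sym.
    by rewrite -[s]subr0 -[(s - 0)%R]add0r (chord_midpoint neq Ek) trimmed_z.
  apply: eq_big => [k|k _]; first by rewrite eqxx.
  case kJ: (k \in J); first by rewrite chord_z ?muln1.
  by have := le_fJ k; rewrite kJ muln0 leqn0 => /eqP.
have := le_fm (spokes 1%R); rewrite /= oner_eq0 eqxx -/z.
by rewrite lambda0E; case: (z) => [|[|//]] _; rewrite ?mul1n; [left|right].
Qed.

Theorem proposition1 (n lambda : nat) (hn : 5 <= n) (hlambda : 1 < lambda)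
    (hlow : n - 2 <= 3 * lambda) (hup : lambda <= n - 2)
    (heven : ~~ odd (n - lambda)) :
  exists M : {mset {set {set 'I_(2 * n)}}},
    [/\ one_factorization lambda M,
        ~ decomposable lambda M &
        ~ simple_factorization M].
Proof.
have n_gt1 : 1 < n by lia.
pose R := 'Z_n.
have cardR : #|{: R}| = n by rewrite card_ord Zp_cast.
have natR0 k : (k%:R == 0 :> R)%R = (n %| k).
  by rewrite -val_eqE /= val_Zp_nat.
have four : (4 != 0 :> R)%R by rewrite natR0; apply/negP=> /dvdn_leq; lia.
(* For n = 6 the set J must not contain two opposite residues; an initial
   segment of at most n - 3 residues has this property. *)
pose J := [set k : R | k < lambda.-1].
have cardJ : #|J| = lambda.-1.
  have le_l : lambda.-1 <= (Zp_trunc n).+2 by rewrite Zp_cast //; lia.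
  rewrite -sum1_card (eq_bigl (fun k : R => k < lambda.-1)) => [|k]; last first.
    by rewrite inE.
  by rewrite -(big_ord_widen _ (fun=> 1) le_l) sum1_card card_ord.
apply: (@factorization_of_pairings n lambda (label R) (R + R)%type
  (fun a => shifted_double (partner J a) (shift a)) (multiplicity J lambda)).
- by rewrite card_sum cardR mul2n addnn.
- by move=> a; apply: shifted_doubleK; apply: partnerK.
- by move=> a x; apply: shifted_double_free.
- by move=> x y; apply: double_cover; rewrite // ltnW.
- move=> f l0; apply: double_indecomposable => //; first exact: ltnW.
  move=> k kJ /eqP; rewrite natR0 => n6.
  have En : n = 6.
    have := @dvdn_leq n 6 isT n6; case/dvdnP: n6 => q; nia.
  have val_k3 : (k + 3 : R)%R = (k + 3) %% n :> nat.
    by rewrite -[k in LHS]natr_Zp -natrD val_Zp_nat.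
  move: kJ; rewrite !inE -leqNgt val_k3 => kJ; lia.
- have two : (2 != 0 :> R)%R by rewrite natR0; apply/negP=> /dvdn_leq; lia.
  exists (spokes 2%R); rewrite /= (negPf two) -subr_eq0.
  by rewrite (_ : 2 - 1 = 1 :> R)%R ?oner_eq0 //; ring.
Qed.
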